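(* For every $\varepsilon > 0$, all reals $\lambda > \lambda' > 0$, and every functional $M_1 : \mathbb{N}^{\mathbb{N}} \to \mathbb{N}$, there is a functional $M_2 : \mathbb{N}^{\mathbb{N}} \to \mathbb{N}$ such that, for any probability space $(X, \mathcal{B}, \mu)$ and any sequence $(f_n)_{n \in \mathbb{N}}$ of nonnegative measurable functions on $X$ dominated by the constant function $1$ (that is, $0 \leq f_n \leq 1$), if $M_1$ is a $\lambda'$-uniform bound on the $\varepsilon$-metastable pointwise convergence of $(f_n)$, then $M_2$ is a bound on the $(\varepsilon + \lambda)$-metastable convergence of the sequence of reals $(\int f_n \, d\mu)$. In other words, if for every $F : \mathbb{N} \to \mathbb{N}$ \[ \mu(\{x \in X : \exists m \leq M_1(F)\ \forall n, n' \in [m,F(m)]\ |f_n(x) - f_{n'}(x)| < \varepsilon\}) > 1 - \lambda', \] then for every $F : \mathbb{N} \to \mathbb{N}$ there is an $m \leq M_2(F)$ such that \[ \forall n, n' \in [m,F(m)]\quad \left| \int f_n \, d\mu - \int f_{n'} \, d\mu \right| < \varepsilon + \lambda. \]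
   Context: A functional is an arbitrary map $M$ assigning a natural number $M(F)$ to each function $F : \mathbb{N} \to \mathbb{N}$. For natural numbers $m, k$, $[m,k]$ denotes $\{n \in \mathbb{N} : m \leq n \leq k\}$ (empty if $k < m$). A functional $M$ is a $\lambda$-uniform bound on the $\varepsilon$-metastable pointwise convergence of $(f_n)$ if for every $F : \mathbb{N} \to \mathbb{N}$, \[ \mu(\{x : \forall m \leq M(F)\ \exists n, n' \in [m,F(m)]\ |f_n(x) - f_{n'}(x)| \geq \varepsilon\}) < \lambda. \] A functional $M$ is a bound on the $\delta$-metastable convergence of a sequence of reals $(a_n)$ if for every $F : \mathbb{N} \to \mathbb{N}$ there is an $m \leq M(F)$ such that $|a_n - a_{n'}| < \delta$ for all $n, n' \in [m,F(m)]$. The functional $M_2$ depends only on $\varepsilon, \lambda, \lambda', M_1$, and not on the probability space or the sequence. *)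

(* Defs.v *)
From HB Require Import structures.
From mathcomp Require Import all_boot all_order all_algebra.
From mathcomp Require Import all_classical all_reals all_analysis.

Set Implicit Arguments.
Unset Strict Implicit.
Unset Printing Implicit Defensive.

Import Order.TTheory GRing.Theory Num.Theory.
Import numFieldNormedType.Exports.

Local Open Scope classical_set_scope.
Local Open Scope ring_scope.

Definition functional := (nat -> nat) -> nat.

Definition uniform_metastable_pointwise_bound (R : realType) (d : measure_display)
    (T : measurableType d) (mu : probability T R) (lambda eps : R)
    (f : nat -> T -> R) (M : functional) : Prop :=
  forall F : nat -> nat,
    (mu [set x | forall m : nat, (m <= M F)%N ->
           exists n n' : nat, [/\ (m <= n <= F m)%N, (m <= n' <= F m)%N &
             (eps <= `|f n x - f n' x|)%R]]
     < lambda%:E)%E.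

Definition metastable_bound (R : realType) (delta : R) (a : nat -> R)
    (M : functional) : Prop :=
  forall F : nat -> nat,
    exists2 m : nat, (m <= M F)%N &
      forall n n' : nat, (m <= n <= F m)%N -> (m <= n' <= F m)%N ->
        `|a n - a n'| < delta.

(* Main.v *)
Require Import Defs.
From HB Require Import structures.
From mathcomp Require Import all_boot all_order all_algebra.
From mathcomp Require Import all_classical all_reals all_analysis.
From mathcomp Require Import measurable_realfun lra.

(** The heart of the matter is a metastable Egorov theorem: there is a bound
[M2], depending only on [lambda], [lambda'] and [M1], such that for every [F]
some stage [m <= M2 F] satisfies [mu (A m) < lambda], where
[A m = oscillation_set f eps m (F m)] is the set of points at which [f]
oscillates by at least [eps] on [[m, F m]].  At such a stage,
[`|f n - f n'| <= eps + \1_(A m)] pointwise for [n], [n'] in [[m, F m]], and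
integrating gives the bound [eps + mu (A m) < eps + lambda].

On a single probability space, with [mu (A m) >= lambda] for all [m], the
argument would be a reverse Fatou lemma.  The measures of the unions
[U m N = \bigcup_(m <= j <= N) A j] increase with [N] to some limit, so there is
[g m] such that extending the union beyond [g m] gains less than [e m], with
[\sum_m e m] at most [lambda - lambda'].  If [m <= k <= N] and [g m <= N], then
both [A k] and [U m (g m)] lie in [U m N]; thus [A k] loses less than [e m] when
intersected with [U m (g m)], and
[mu (\bigcap_(m <= k) U m (g m)) >= lambda - \sum_(m <= k) e m > lambda'].
A point of [U m (g m)] lies in some [A j] with [m <= j <= g m], hence oscillates
on [[m, F' m]] with [F' m = \max_(j <= g m) F j].  For [k = M1 F'] this
contradicts the hypothesis on [M1].

This reasoning uses [mu (A k) >= lambda] for the single value [k = M1 F'], and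
compares [U m (g m)] with [U m N] for finitely many [m] and a single [N].  What
remains is to bound [k] independently of the space, although [g], and with it
[F'], depends on the space.  This is a compactness statement on double sequences
of numbers in [[0, 1]], here the measures [mu (U m N)]: if no bound [K] worked
there would be a bad double sequence for each [K], and along an ultrafilter on
[K] a single [g] stabilizes almost all of them (lemma
[uniform_stabilization]).  It applies to an arbitrary [M1], since [M1] is
evaluated once [g] is completely known. *)

Set Implicit Arguments.
Unset Strict Implicit.
Unset Printing Implicit Defensive.

Import Order.TTheory GRing.Theory Num.Theory.
Import numFieldNormedType.Exports.

Local Open Scope classical_set_scope.
Local Open Scope ring_scope.

(** * Stabilization along an ultrafilter *)

(** The index [N0] almost realizes the supremum of the numbers [t] such that
some [p _ N] is at least [t] almost everywhere.  Dichotomy for ultrafilters turns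
the failure of [t <= p _ N] almost everywhere into [p _ N < t] almost
everywhere. *)
Lemma ultra_almost_max (R : realType) (T : Type) (U : set_system T)
    (UF : UltraFilter U) (p : T -> nat -> R) (e : R) :
  0 < e -> (forall x N, 0 <= p x N <= 1) ->
  exists N0, forall N, \forall x \near U, p x N < p x N0 + e.
Proof.
move=> e0 p01.
pose E : set R := [set t | exists N, \forall x \near U, t <= p x N].
have supE : has_sup E.
  split.
    by exists 0, 0%N; apply: filterE => x; have /andP[] := p01 x 0%N.
  exists 1 => t [N /filter_ex[x tp]].
  by apply: le_trans tp _; have /andP[] := p01 x N.
have e20 : 0 < e / 2 by lra.
have [t [N0 tN0] supt] := sup_adherent e20 supE.
exists N0 => N.
have [tN|] := in_ultra_setVsetC [set x | sup E + e / 2 <= p x N] UF.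
  have : sup E + e / 2 <= sup E by apply: ub_le_sup; [case: supE|exists N].
  by move=> ?; exfalso; lra.
move=> pN; apply: filterS2 tN0 pN => x /= tx /negP; rewrite -ltNge; lra.
Qed.

(** A uniform version of the fact that bounded monotone sequences are Cauchy.
The bound [K] is the same for all double sequences [p], while [g] may depend on
[p].  The functionals [k] and [h] are arbitrary: in the limit argument they are
applied to a single [g], the one that stabilizes almost all elements of a
sequence of counterexamples. *)
Lemma uniform_stabilization (R : realType) (e : nat -> R) (k h : functional) :
  (forall m, 0 < e m) ->
  exists K, forall p : nat -> nat -> R, (forall m N, 0 <= p m N <= 1) ->
    exists2 g : nat -> nat, (k g <= K)%N &
      forall m, (m <= k g)%N -> p m (h g) < p m (g m) + e m.
Proof.
move=> e0; apply: contrapT => /forallNP noK.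
have /choice[p pP] : forall K, exists p : nat -> nat -> R,
    (forall m N, 0 <= p m N <= 1) /\
    ~ exists2 g : nat -> nat, (k g <= K)%N &
      forall m, (m <= k g)%N -> p m (h g) < p m (g m) + e m.
  by move=> K; have /existsNP[p /not_implyP[]] := noK K; exists p.
have [U [UF ooU]] := ultraFilterLemma (F := \oo) _.
have /choice[g gP] m :=
  @ultra_almost_max R nat U UF (fun K => p K m) (e m) (e0 m)
    (fun K => (pP K).1 m).
have : \forall K \near U, (k g <= K)%N /\
    forall i : 'I_(k g).+1, p K i (h g) < p K i (g i) + e i.
  apply: filterI; first exact: (ooU _ (nbhs_infty_ge (k g))).
  by apply: filter_forall => i; exact: gP.
move=> /filter_ex[K [kK stab]]; apply: (pP K).2; exists g => // m mk.
exact: (stab (Ordinal (mk : (m < (k g).+1)%N))).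
Qed.

(** * Measures of finite intersections *)

(** Intersecting [A] with [C m] removes part of [D m `\` C m] only, of measure
at most [e m]. *)
Lemma le_measure_bigcap_cover (R : realType) (d : measure_display)
    (X : measurableType d) (mu : probability X R) (A : set X)
    (C D : nat -> set X) (e : nat -> R) (n : nat) :
  measurable A ->
  (forall m, measurable (C m)) -> (forall m, measurable (D m)) ->
  (forall m, (m < n)%N ->
    [/\ A `<=` D m, C m `<=` D m & (mu (D m) <= mu (C m) + (e m)%:E)%E]) ->
  (mu A <= mu (A `&` \bigcap_(m < n) C m) + (\sum_(m < n) e m)%:E)%E.
Proof.
move=> mA mC mD; elim: n => [|n IH] H.
  by rewrite bigcap_mkord !big_ord0 setIT adde0.
apply: le_trans (IH _) _ => [m mn|]; first exact/H/ltnW.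
have [AD CD De] := H n (ltnSn n).
rewrite big_ord_recr/= addrC EFinD addeA leeD2r//.
have mB l : measurable (\bigcap_(m < l) C m).
  by apply: bigcap_measurableType => m _.
have muDC : (mu (D n `\` C n) <= (e n)%:E)%E.
  rewrite measureD//; last by rewrite ltey_eq fin_num_measure.
  by rewrite (setIidr CD) leeBlDl// fin_num_measure.
apply: le_trans (leeD2l _ muDC).
apply: le_trans (measureU2 _ _ _); last 2 first.
- exact: measurableI.
- exact: measurableD.
apply: le_measure; rewrite ?inE; first exact: measurableI.
  by apply: measurableU; [exact: measurableI|exact: measurableD].
move=> x [Ax Bx]; have [Cx|nCx] := pselect (C n x); last first.
  by right; split => //; exact: AD.
left; split => // m /=; rewrite ltnS leq_eqVlt => /predU1P[->//|]; exact: Bx.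
Qed.

(** * The metastable Egorov theorem *)

Definition oscillation_set (R : realType) (X : Type) (f : nat -> X -> R)
    (eps : R) (m N : nat) : set X :=
  [set x | exists n n' : nat, [/\ (m <= n <= N)%N, (m <= n' <= N)%N &
    eps <= `|f n x - f n' x|]].

Lemma measurable_oscillation_set (R : realType) (d : measure_display)
    (X : measurableType d) (f : nat -> X -> R) (eps : R) (m N : nat) :
  (forall n, measurable_fun [set: X] (f n)) ->
  measurable (oscillation_set f eps m N).
Proof.
move=> mf.
have -> : oscillation_set f eps m N =
    \bigcup_(n in [set n | (m <= n <= N)%N])
      \bigcup_(n' in [set n' | (m <= n' <= N)%N])
        [set x | eps <= `|f n x - f n' x|].
  apply/seteqP; split => x /=.
    by move=> [n [n' [mn mn' fx]]]; exists n => //; exists n'.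
  by move=> [n mn [n' mn' fx]]; exists n, n'.
apply: bigcup_measurable => n _; apply: bigcup_measurable => n' _.
rewrite -[X in measurable X]setTI; apply: measurable_fun_le => //.
by apply: measurableT_comp => //; exact: measurable_funB.
Qed.

Lemma sub_oscillation_set (R : realType) (X : Type) (f : nat -> X -> R)
    (eps : R) (m N m' N' : nat) :
  (m' <= m)%N -> (N <= N')%N ->
  oscillation_set f eps m N `<=` oscillation_set f eps m' N'.
Proof.
move=> mm NN x [n [n' [/andP[mn nN] /andP[mn' nN'] fx]]].
exists n, n'; split => //; apply/andP; split.
- exact: leq_trans mm mn.
- exact: leq_trans nN NN.
- exact: leq_trans mm mn'.
- exact: leq_trans nN' NN.
Qed.

Lemma sum_half_powers_lt (R : realType) (c : R) (n : nat) :
  0 < c -> \sum_(m < n) c / 2 ^+ m.+1 < c.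
Proof.
move=> c0; suff -> : \sum_(m < n) c / 2 ^+ m.+1 = c - c / 2 ^+ n.
  by rewrite gtrBl divr_gt0 ?exprn_gt0.
elim: n => [|n IH]; first by rewrite big_ord0 expr0 divr1 subrr.
rewrite big_ord_recr/= IH exprS invfM; lra.
Qed.

(** The stage found for [F] is [k F g], where [g] comes from
[uniform_stabilization]: if [A (k F g)] had measure at least [lambda], then too
large a part of it would lie in the set that the hypothesis on [M1] bounds. *)
Theorem metastable_egorov (R : realType) (eps lambda lambda' : R)
    (lambda'_lt : lambda' < lambda) (M1 : functional) :
  exists M2 : functional,
    forall (d : measure_display) (X : measurableType d)
      (mu : probability X R) (f : nat -> X -> R),
      (forall n, measurable_fun [set: X] (f n)) ->
      uniform_metastable_pointwise_bound mu lambda' eps f M1 ->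
      forall F : nat -> nat, exists2 m, (m <= M2 F)%N &
        (mu (oscillation_set f eps m (F m)) < lambda%:E)%E.
Proof.
pose c := lambda - lambda'.
have c0 : 0 < c by rewrite subr_gt0.
pose e m : R := c / 2 ^+ m.+1.
have e0 m : 0 < e m by rewrite divr_gt0 ?exprn_gt0.
pose F' (F g : nat -> nat) m := (\max_(j < (g m).+1) F j)%N.
pose k F g := M1 (F' F g).
(* Large enough for [V m (h F g)], defined below, to contain both [A (k F g)]
   and [V m (g m)] for all [m <= k F g]. *)
pose h F g := (\max_(m < (k F g).+1) maxn m (g m))%N.
have /choice[M2 M2P] F := @uniform_stabilization R e (k F) (h F) e0.
exists M2 => d X mu f mf fM1 F.
pose A m := oscillation_set f eps m (F m).
pose V m N := \bigcup_(j in [set j | (m <= j <= N)%N]) A j.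
have mA m : measurable (A m) by exact: measurable_oscillation_set.
have mV m N : measurable (V m N) by apply: bigcup_measurable => j _.
have [m N|g kgM stab] := M2P F (fun m N => fine (mu (V m N))).
  rewrite fine_ge0//= -lee_fin fineK ?fin_num_measure//.
  exact: probability_le1.
exists (k F g) => //.
have hP m : (m <= k F g)%N -> (maxn m (g m) <= h F g)%N.
  move=> mk; exact: (@leq_bigmax _ (fun i : 'I_(k F g).+1 => maxn i (g i))
    (Ordinal (mk : (m < (k F g).+1)%N))).
have cover := @le_measure_bigcap_cover R d X mu (A (k F g))
  (fun m => V m (g m)) (fun m => V m (h F g)) e (k F g).+1 (mA _)
  (fun=> mV _ _) (fun=> mV _ _).
apply: le_lt_trans (cover _) _ => [m|].
  rewrite ltnS => mk; split.
  - move=> x Ax; exists (k F g) => //=; rewrite mk/=.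
    by have := hP _ (leqnn (k F g)); rewrite geq_max => /andP[].
  - apply: bigcup_subset => j /= /andP[-> jg]/=; apply: leq_trans jg _.
    by have := hP _ mk; rewrite geq_max => /andP[].
  - have := ltW (stab _ mk); rewrite -lee_fin EFinD !fineK//;
    exact: fin_num_measure.
have bad_lt : (mu (A (k F g) `&` \bigcap_(m < (k F g).+1) V m (g m)) <
    lambda'%:E)%E.
  apply: le_lt_trans (fM1 (F' F g)).
  apply: le_measure; rewrite ?inE.
  - by apply: measurableI => //; apply: bigcap_measurableType.
  - rewrite [X in measurable X](_ : _ = \bigcap_(m < (k F g).+1)
      oscillation_set f eps m (F' F g m)).
      by apply: bigcap_measurableType => m _; exact: measurable_oscillation_set.
    by apply/seteqP; split => x /= H m; exact: H.
  - move=> x [_ Vx] m mk.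
    have [j /= /andP[mj jg] Ajx] := Vx m mk.
    apply: (sub_oscillation_set mj _ Ajx).
    exact: (@leq_bigmax _ (fun i : 'I_(g m).+1 => F i)
      (Ordinal (jg : (j < (g m).+1)%N))).
have -> : lambda = lambda' + c by rewrite /c; lra.
rewrite EFinD lteD// lte_fin; exact: sum_half_powers_lt.
Qed.

(** * Integrals *)

Lemma Rintegral_oscillation_le (R : realType) (d : measure_display)
    (X : measurableType d) (mu : probability X R) (f : nat -> X -> R)
    (eps : R) (m N n n' : nat) :
  0 <= eps ->
  (forall i, measurable_fun [set: X] (f i)) -> (forall i x, 0 <= f i x <= 1) ->
  (m <= n <= N)%N -> (m <= n' <= N)%N ->
  `|\int[mu]_x f n x - \int[mu]_x f n' x| <=
    eps + fine (mu (oscillation_set f eps m N)).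
Proof.
move=> eps0 mf f01 mn mn'.
set A := oscillation_set f eps m N.
have mA : measurable A by exact: measurable_oscillation_set.
have intb (g : X -> R) (b : R) : measurable_fun [set: X] g ->
    (forall x, `|g x| <= b) -> mu.-integrable [set: X] (EFin \o g).
  move=> mg gb; apply: measurable_bounded_integrable => //.
    by rewrite ltey_eq fin_num_measure.
  exists b; split; first exact: num_real.
  by move=> y ltby x _ /=; apply: le_trans (gb x) (ltW ltby).
have intf i : mu.-integrable [set: X] (EFin \o f i).
  apply: (intb _ 1) => // x.
  by have /andP[f0 f1] := f01 i x; rewrite ger0_norm.
have fB1 x : `|f n x - f n' x| <= 1.
  have /andP[? ?] := f01 n x; have /andP[? ?] := f01 n' x.
  by rewrite ler_norml; apply/andP; split; lra.
have mB : measurable_fun [set: X] (fun x => f n x - f n' x).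
  exact: measurable_funB.
have intA : mu.-integrable [set: X] (EFin \o \1_A).
  exact: integrable_indic.
have inteps : mu.-integrable [set: X] (EFin \o cst eps).
  exact: finite_measure_integrable_cst.
rewrite -RintegralB//.
apply: le_trans (le_normr_Rintegral _ (intb _ 1 mB fB1)) _ => //.
have -> : eps + fine (mu A) = \int[mu]_x (eps + \1_A x).
  rewrite RintegralD// Rintegral_cst//; congr (_ + _).
    by rewrite -[LHS]mulr1 -[1]/(fine 1) -(probability_setT mu).
  by rewrite [in RHS]/Rintegral integral_indic// setIT.
apply: le_Rintegral => //.
- apply: (intb _ 1) => [|x]; last by rewrite normr_id.
  exact: measurableT_comp.
- by have := integrableD measurableT inteps intA.
move=> x _; rewrite indicE.
have [xA|/negP nxA] := boolP (x \in A); first by have := fB1 x; rewrite /=; lra.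
rewrite addr0 leNgt; apply/negP => epsx; apply: nxA; rewrite inE.
by exists n, n'; split => //; exact: ltW.
Qed.

Theorem theorem3p2 (R : realType) (eps lambda lambda' : R)
    (eps_gt0 : 0 < eps) (lambda'_gt0 : 0 < lambda')
    (lambda'_lt : lambda' < lambda) (M1 : functional) :
  exists M2 : functional,
    forall (d : measure_display) (X : measurableType d)
      (mu : probability X R) (f : nat -> X -> R),
      (forall n, measurable_fun [set: X] (f n)) ->
      (forall n x, 0 <= f n x <= 1) ->
      uniform_metastable_pointwise_bound mu lambda' eps f M1 ->
      metastable_bound (eps + lambda) (fun n => \int[mu]_x f n x) M2.
Proof.
have [M2 M2P] := @metastable_egorov R eps lambda lambda' lambda'_lt M1.
exists M2 => d X mu f mf f01 fM1 F.
have [m mM2 mulam] := M2P d X mu f mf fM1 F.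
exists m => // n n' mn mn'.
apply: le_lt_trans (Rintegral_oscillation_le mu (ltW eps_gt0) mf f01 mn mn') _.
rewrite ltrD2l -lte_fin fineK// fin_num_measure//.
exact: measurable_oscillation_set.
Qed.
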